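(* Let $a,b,c,d>0$. Then for all $0\le k\le n$, $$\frac{\partial}{\partial y}\left[W^{(a,b,c,d)}(x,y)\,H_{n,k}^{(a,b,c,d)}(x,y)\right]=-d_k^{(d,c)}\,W^{(a,b,c-1,d-1)}(x,y)\,H_{n+1,k+1}^{(a,b,c-1,d-1)}(x,y),$$ and thus the matrix $W_y^{(a,b,c,d)}$, defined by $\frac{\partial}{\partial y}\mathbf W^{(a,b,c,d)}=\mathbf W^{(a,b,c-1,d-1)}W_y^{(a,b,c,d)}$, has block-bandwidths $(1,-1)$ and each block has bandwidths $(1,-1)$.
   Context: Setting. Let $\alpha<\beta$ and $\gamma<\delta$ be real, and let $\rho$ be a function on $[\alpha,\beta]$, positive on $(\alpha,\beta)$, with either: case (i), $\rho$ is a polynomial of degree $d_0$; or case (ii), $\rho$ is the square root of a polynomial of degree $d_1=\deg\rho^2$ and $\delta=-\gamma>0$. Put $\eta=0$ in case (i), $\eta=1$ in case (ii), so $d_\eta=\deg\rho^{1+\eta}$; assume $d_\eta\ge 2+\eta$. Let $\Omega=\{(x,y):\alpha\le x\le\beta,\ \gamma\rho(x)\le y\le\delta\rho(x)\}$. All parameters are real, families of orthogonal polynomials have parameters $>-1$ and integrable weights, and $c=d$ in case (ii). Polynomials. $w_R^{(a,b,s)}(x)=(\beta-x)^a(x-\alpha)^b\rho(x)^s$ on $[\alpha,\beta]$, and $R_n^{(a,b,s)}$ ($n\ge0$) are the orthonormal polynomials (degree $n$, positive leading coefficient) for this weight. $w_P^{(d,c)}(y)=(\delta-y)^d(y-\gamma)^c$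 on $[\gamma,\delta]$, with orthonormal polynomials $\widetilde P_n^{(d,c)}$ (shifted normalised Jacobi polynomials, positive leading coefficient); constants $d_{n}^{(d,c)}$ are defined by $\frac{\mathrm d}{\mathrm dy}\widetilde P_{n}^{(d,c)}=d_{n-1}^{(d+1,c+1)}\widetilde P_{n-1}^{(d+1,c+1)}$ (so $\frac{\mathrm d}{\mathrm dy}\widetilde P_{k+1}^{(d-1,c-1)}=d_k^{(d,c)}\widetilde P_k^{(d,c)}$). The generalised Koornwinder polynomials are $$H_{n,k}^{(a,b,c,d)}(x,y)=R_{n-k}^{(a,b,c+d+2k+1)}(x)\,\rho(x)^k\,\widetilde P_k^{(d,c)}(y/\rho(x)),\quad 0\le k\le n,$$ orthonormal on $\Omega$ with respect to $W^{(a,b,c,d)}(x,y)=(\beta-x)^a(x-\alpha)^b(y-\gamma\rho(x))^c(\delta\rho(x)-y)^d$. $\mathbf H^{(a,b,c,d)}$ is the infinite row vector of all $H_{n,k}^{(a,b,c,d)}$, ordered in blocks $n=0,1,2,\dots$, block $n$ being $(H_{n,0},\dots,H_{n,n})$, and $\mathbf W^{(a,b,c,d)}=W^{(a,b,c,d)}\mathbf H^{(a,b,c,d)}$. Conventions. $A_{[i,j]}$ is the entry in row $i+1$, column $j+1$ of $A$. A matrix has bandwidths $(\sigma,\mu)$ if $A_{[i,j]}=0$ whenever $i-j>\sigma$ or $j-i>\mu$ ($\sigma$ or $\mu$ may be negative); block-bandwidths are defined in the same way, with block $(i,j)$ (of size $(i+1)\times(j+1)$) in place of entry $[i,j]$,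 and ''each block has bandwidths'' refers to bandwidths within the blocks. *)

(* Defs.v *)
From mathcomp Require Import all_boot all_order all_algebra.
From mathcomp Require Import all_classical all_reals all_analysis.
Set Implicit Arguments.
Unset Strict Implicit.
Unset Printing Implicit Defensive.
Import Order.TTheory GRing.Theory Num.Theory.
Import numFieldNormedType.Exports.
Local Open Scope classical_set_scope.
Local Open Scope ring_scope.

(* [p n] has degree exactly [n].  The [Rintegral] is only meaningful for a
   weight [w] integrable on [lo, hi], which users of this predicate assume (or
   know) separately. *)
Definition orthonormal_polys (R : realType) (lo hi : R) (w : R -> R)
    (p : nat -> {poly R}) : Prop :=
  [/\ forall n, size (p n) = n.+1,
      forall n, 0 < lead_coef (p n) &
      forall m n, (\int[lebesgue_measure]_(x in `[lo, hi])
                      ((p m).[x] * (p n).[x] * w x))%R = (m == n)%:R].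

(* [eta = false]: rho is a polynomial of degree >= 2;
   [eta = true]: rho is the square root of a polynomial of degree >= 3 and the
   interval [gamma, delta] is symmetric.  Only the values of [rho] on
   [alpha, beta] are constrained. *)
Definition admissible_rho (R : realType) (alpha beta gamma delta : R)
    (rho : R -> R) (eta : bool) : Prop :=
  [/\ forall x, alpha < x < beta -> 0 < rho x,
      exists q : {poly R},
        (2 + eta <= (size q).-1)%N /\
        forall x, alpha <= x <= beta ->
          rho x = if eta then Num.sqrt q.[x] else q.[x] &
      eta -> delta = - gamma /\ 0 < delta].

Section Koornwinder.
Variables (R : realType) (alpha beta gamma delta : R) (rho : R -> R).

Definition weightR (a b s : R) (x : R) : R :=
  (beta - x) `^ a * (x - alpha) `^ b * rho x `^ s.

Definition weightP (d c : R) (y : R) : R :=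
  (delta - y) `^ d * (y - gamma) `^ c.

Definition integrable_weightR (a b s : R) : Prop :=
  lebesgue_measure.-integrable `[alpha, beta] (EFin \o weightR a b s).

(* [Rp a b s n] is R_n^(a,b,s). *)
Definition is_Rfamily (Rp : R -> R -> R -> nat -> {poly R}) : Prop :=
  forall a b s, -1 < a -> -1 < b -> -1 < s -> integrable_weightR a b s ->
    orthonormal_polys alpha beta (weightR a b s) (Rp a b s).

(* [Pt d c n] is the shifted normalised Jacobi polynomial of degree n; its
   weight is always integrable since d, c > -1. *)
Definition is_Pfamily (Pt : R -> R -> nat -> {poly R}) : Prop :=
  forall d c, -1 < d -> -1 < c ->
    orthonormal_polys gamma delta (weightP d c) (Pt d c).

(* The constant e such that (Pt_{k+1}^(d-1,c-1))' = e Pt_k^(d,c). *)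
Definition dconst (Pt : R -> R -> nat -> {poly R}) (d c : R) (k : nat) : R :=
  xget 0 [set e : R | (Pt (d - 1) (c - 1) k.+1)^`() = e *: Pt d c k].

Definition weightW (a b c d : R) (x y : R) : R :=
  (beta - x) `^ a * (x - alpha) `^ b
  * (y - gamma * rho x) `^ c * (delta * rho x - y) `^ d.

(* Meaningful for k <= n only. *)
Definition koornwinder (Rp : R -> R -> R -> nat -> {poly R})
    (Pt : R -> R -> nat -> {poly R}) (a b c d : R) (n k : nat) (x y : R) : R :=
  (Rp a b (c + d + 2 * k%:R + 1) (n - k)%N).[x] * rho x ^+ k
  * (Pt d c k).[y / rho x].

(* The points of Omega where the derivative in y is taken: W is singular, or
   only one-sidedly differentiable, on the arcs y = gamma rho(x) and
   y = delta rho(x). *)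
Definition yinterior (x y : R) : Prop :=
  alpha <= x <= beta /\ gamma * rho x < y < delta * rho x.

End Koornwinder.

Definition bandwidths (R : realType) (m n : nat) (sigma mu : int)
    (A : 'M[R]_(m, n)) : Prop :=
  forall (i : 'I_m) (j : 'I_n),
    (sigma < i%:Z - j%:Z) || (mu < j%:Z - i%:Z) -> A i j = 0.

(* Infinite matrix acting on the block row vector (H_{n,k})_{k <= n}:
   [M i j k l] is the entry in row (i, k) and column (j, l). *)
Definition inf_blockmx (R : realType) : Type :=
  forall i j : nat, 'M[R]_(i.+1, j.+1).

Definition block_bandwidths (R : realType) (sigma mu : int)
    (M : inf_blockmx R) : Prop :=
  forall i j : nat,
    (sigma < i%:Z - j%:Z) || (mu < j%:Z - i%:Z) -> M i j = 0.

(* d/dy WW^(a,b,c,d) = WW^(a,b,c-1,d-1) M, entry by entry.  The columns of [M]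
   have finitely many nonzero entries, so that the product is a finite sum;
   with convergent infinite sums the equation would not determine [M]. *)
Definition is_Wy (R : realType) (alpha beta gamma delta : R) (rho : R -> R)
    (Rp : R -> R -> R -> nat -> {poly R}) (Pt : R -> R -> nat -> {poly R})
    (a b c d : R) (M : inf_blockmx R) : Prop :=
  forall (j : nat) (l : 'I_j.+1), exists N : nat,
    (forall (i : nat) (k : 'I_i.+1), (N <= i)%N -> M i j k l = 0) /\
    (forall x y, yinterior alpha beta gamma delta rho x y ->
      is_derive y 1
        (fun t => weightW alpha beta gamma delta rho a b c d x t
                  * koornwinder rho Rp Pt a b c d j l x t)
        (\sum_(i < N) \sum_(k < i.+1)
           weightW alpha beta gamma delta rho a b (c - 1) (d - 1) x y
           * koornwinder rho Rp Pt a b (c - 1) (d - 1) i k x y * M i j k l)).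

(* Main.v *)
Require Import Defs.
From HB Require Import structures.
From mathcomp Require Import all_boot all_order all_algebra.
From mathcomp Require Import all_classical all_reals all_analysis.
From mathcomp Require Import measurable_realfun.
From mathcomp Require Import ring lra zify.
Import Order.TTheory GRing.Theory Num.Theory.
Import numFieldNormedType.Exports.
Local Open Scope classical_set_scope.
Local Open Scope ring_scope.
Set Implicit Arguments.
Unset Strict Implicit.
Unset Printing Implicit Defensive.

(** For fixed [x] put [r = rho x] and [s = y / r].  Up to a factor that does not
    depend on [y], the function [W H_{n,k}] is the univariate function
    [w^(d,c)(s) P_k^(d,c)(s)], where [w^(d,c)] is the Jacobi weight, so the
    derivative formula is the Rodrigues-type identity
      [(w^(d,c) P_k^(d,c))' = - d_k w^(d-1,c-1) P_{k+1}^(d-1,c-1)].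
    The parameter of the [x]-polynomial matches by itself:
    [(c-1) + (d-1) + 2(k+1) + 1 = c + d + 2k + 1].

    The univariate identity is a duality argument.  Differentiating
    [w^(d,c) q] gives [w^(d-1,c-1) J q], where the operator [J]
    ([jacobi_raise]) raises degrees by at most one.  Both boundary terms of
    [w^(d,c) q] vanish because [c, d > 0], so integration by parts makes [- J]
    the adjoint of [d/dy] with respect to the two inner products.  An operator
    and its adjoint, one lowering and one raising degrees by one, must map one
    orthonormal family to the other with the same constants up to sign
    ([deriv_ladder], [adjoint_ladder]).  The first of these lemmas shows that
    the constant [dconst] has its defining property.  The integration by parts
    is improper, since [w^(d-1,c-1)] may blow up at the end points; it rests on
    [improper_FTC2].

    For the matrix, the derivative formula provides one solution, supported on
    [i = j + 1], [k = l + 1].  Uniqueness is the linear independence of the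
    functions [W H_{n,k}] on the interior ([koornwinder_free]): with
    [y = t rho x] one separates first the degrees in [t], then the degrees in
    [x].  Independence only uses the degrees of the [R_n^(a,b,s)], which are
    known when their weights are integrable; [rho] being bounded, this follows
    from integrability for the smallest exponent [s = c + d - 1]
    ([integrable_weightR_incr]). *)

(** * Linear independence of polynomials of increasing degree *)

(** Induction on [N]: a nonzero top coefficient would make the last term
    larger in degree than all the others together. *)
Lemma size_incr_free (R : fieldType) (q : nat -> {poly R}) (P : pred nat) :
  (forall i, P i -> q i != 0) ->
  (forall i j, P i -> P j -> (i < j)%N -> (size (q i) < size (q j))%N) ->
  forall (N : nat) (c : nat -> R), \sum_(i < N | P i) c i *: q i = 0 ->
  forall i, (i < N)%N -> P i -> c i = 0.
Proof.
move=> q0 qincr; elim=> [//|N IHN] c.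
rewrite big_mkcond big_ord_recr -big_mkcond /=; case: ifPn => [PN|PN sum0].
  have [cN|cN0] := eqVneq (c N) 0.
    rewrite cN scale0r addr0 => /IHN cI i; rewrite ltnS leq_eqVlt.
    by case/predU1P => [-> //|/cI].
  move=> /eqP; rewrite addrC addr_eq0 => /eqP/(congr1 (size \o polyseq)) /=.
  rewrite size_scale // size_polyN => sizeqN.
  suff : (size (q N) < size (q N))%N by rewrite ltnn.
  rewrite [ltnLHS]sizeqN.
  apply: (big_ind (fun r : {poly R} => size r < size (q N))%N) => [|r s sr ss|i Pi].
  - by rewrite size_poly0 size_poly_gt0 q0.
  - by apply: leq_ltn_trans (size_polyD _ _) _; rewrite gtn_max sr ss.
  - by apply: leq_ltn_trans (size_scale_leq _ _) _; apply: qincr.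
rewrite addr0 in sum0 => i; rewrite ltnS leq_eqVlt => /predU1P[-> /idPn|iN Pi].
  by rewrite PN.
exact: IHN sum0 i iN Pi.
Qed.

Lemma poly_eq0_itv (R : realFieldType) (lo hi : R) (p : {poly R}) :
  lo < hi -> (forall x, lo < x < hi -> p.[x] = 0) -> p = 0.
Proof.
move=> lohi p0.
pose f i : R := lo + (hi - lo) / i.+2%:R.
have fin i : lo < f i < hi.
  rewrite /f ltrDl divr_gt0 ?subr_gt0 ?ltr0n //= -ltrBrDl ltr_pdivrMr ?ltr0n //.
  by rewrite ltr_pMr ?subr_gt0 // ltr1n.
apply: (@roots_geq_poly_eq0 _ p (mkseq f (size p))); last by rewrite size_mkseq.
  by apply/allP => _ /mapP[i _ ->]; apply/rootP/p0.
rewrite mkseq_uniq // => i j.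
move/addrI/mulfI => /(_ _)/invr_inj ij.
have /ij/eqP : hi - lo != 0 by rewrite subr_eq0 gt_eqF.
by rewrite eqr_nat !eqSS => /eqP.
Qed.

(** * Orthonormal families and adjoint operators *)

Definition orthonormal_for (R : fieldType) (L : {poly R} -> R)
    (p : nat -> {poly R}) : Prop :=
  (forall n, size (p n) = n.+1) /\ (forall m n, L (p m * p n) = (m == n)%:R).

Lemma orth_span (R : fieldType) (p : nat -> {poly R}) (n : nat) (q : {poly R}) :
  (forall i, size (p i) = i.+1) -> (size q <= n)%N ->
  exists c : nat -> R, q = \sum_(i < n) c i *: p i.
Proof.
move=> sizep; elim: n q => [|n IHn] q sizeq.
  by exists (fun=> 0); rewrite big_ord0; apply/eqP; rewrite -size_poly_leq0.
pose e := q`_n / lead_coef (p n).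
have lead0 : lead_coef (p n) != 0 by rewrite lead_coef_eq0 -size_poly_gt0 sizep.
have [|c qE] := IHn (q - e *: p n).
  apply/leq_sizeP => j; rewrite leq_eqVlt coefB coefZ => /predU1P[<-|nj].
    have -> : (p n)`_n = lead_coef (p n) by rewrite lead_coefE sizep.
    by rewrite divfK // subrr.
  by rewrite !nth_default ?mulr0 ?subr0 ?sizep //; exact: leq_trans sizeq nj.
exists (fun i => if i == n then e else c i).
rewrite big_ord_recr /= eqxx -[LHS](subrK (e *: p n)) qE; congr (_ + _).
by apply: eq_bigr => i _; rewrite ltn_eqF.
Qed.

(** A polynomial of degree at most [n] that is orthogonal to all lower degrees
    has a single nonzero coefficient in the orthonormal basis. *)
Lemma orth_proj (R : fieldType) (L : {scalar {poly R}})
    (p : nat -> {poly R}) (n : nat) (q : {poly R}) :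
  orthonormal_for L p -> (size q <= n.+1)%N ->
  (forall r : {poly R}, (size r <= n)%N -> L (q * r) = 0) ->
  q = L (q * p n) *: p n.
Proof.
move=> [sizep orthp] /(orth_span sizep)[c qE] qorth.
have coefE j : (j < n.+1)%N -> c j = L (q * p j).
  move=> jn; rewrite qE mulr_suml linear_sum (bigD1 (Ordinal jn)) //=.
  rewrite -scalerAl linearZ /= orthp eqxx mulr1 big1 ?addr0 // => i ij.
  by rewrite -scalerAl linearZ /= orthp (negPf (ij : val i != j)) mulr0.
rewrite {1}qE big_ord_recr /= coefE // big1 ?add0r // => i _.
by rewrite coefE ?(ltn_trans _ (ltnSn n)) // qorth ?scale0r // sizep.
Qed.

Lemma orth_lower (R : fieldType) (L : {scalar {poly R}})
    (p : nat -> {poly R}) (n : nat) (r : {poly R}) :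
  orthonormal_for L p -> (size r <= n)%N -> L (p n * r) = 0.
Proof.
move=> [sizep orthp] /(orth_span sizep)[c ->].
rewrite mulr_sumr linear_sum big1 // => i _.
by rewrite -scalerAr linearZ /= orthp gtn_eqF // mulr0.
Qed.

(** [Jadj] says that [- J], from the inner product of [L] to that of [L'], is
    the adjoint of the derivative, from the inner product of [L'] to that of
    [L]. *)
Section Ladder.
Variables (R : fieldType) (L L' : {scalar {poly R}}).
Variables (p p' : nat -> {poly R}) (J : {poly R} -> {poly R}).
Hypotheses (Lp : orthonormal_for L p) (Lp' : orthonormal_for L' p').
Hypothesis sizeJ : forall q, (size (J q) <= (size q).+1)%N.
Hypothesis Jadj : forall q r, L (q * r^`()) = - L' (J q * r).

(** [p' k.+1] is orthogonal to [J r] as soon as [r] has degree less than [k],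
    because [J] raises the degree by at most one; by adjunction its derivative
    is orthogonal to [r]. *)
Lemma deriv_ladder k : exists e : R, (p' k.+1)^`() = e *: p k.
Proof.
exists (L ((p' k.+1)^`() * p k)); apply: (orth_proj Lp) => [|r sizer].
  by rewrite -ltnS -(Lp'.1 k.+1) lt_size_deriv // -size_poly_gt0 Lp'.1.
rewrite mulrC Jadj mulrC (orth_lower Lp') ?oppr0 //.
exact: leq_trans (sizeJ r) _.
Qed.

(** The derivative of a polynomial [r] of degree at most [k] has degree less
    than [k], so by adjunction [J (p k)] is orthogonal to [r] and is a multiple
    of [p' k.+1].  The factor is a matrix coefficient of [J], hence minus the
    corresponding one of the derivative, which is [e]. *)
Lemma adjoint_ladder k e : (p' k.+1)^`() = e *: p k -> J (p k) = - e *: p' k.+1.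
Proof.
move=> dp'; rewrite [LHS](orth_proj Lp' (n := k.+1)).
- congr (_ *: _); apply: oppr_inj.
  by rewrite -Jadj dp' -scalerAr linearZ /= Lp.2 eqxx mulr1 opprK.
- by rewrite (leq_trans (sizeJ _)) // Lp.1.
- move=> r sizer; apply: oppr_inj; rewrite -Jadj oppr0 (orth_lower Lp) //.
  have [->|r0] := eqVneq r 0; first by rewrite deriv0 size_poly0.
  by rewrite -ltnS (leq_trans (lt_size_deriv r0)).
Qed.
End Ladder.
(** * Integration against a weight *)

(** [f] may be unbounded near the end points.  Its integral from [lo] to [x] is
    continuous up to the end points and, by the classical theorem on compact
    subintervals, differs from [F] by a constant inside; passing to both limits
    gives the claim. *)
Lemma improper_FTC2 (R : realType) (f F : R -> R) (lo hi : R) : lo < hi ->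
  lebesgue_measure.-integrable `[lo, hi] (EFin \o f) ->
  (forall x, lo < x < hi -> {for x, continuous f}) ->
  (forall x, lo < x < hi -> is_derive x 1 F (f x)) ->
  F x @[x --> lo^'+] --> F lo -> F x @[x --> hi^'-] --> F hi ->
  (\int[lebesgue_measure]_(x in `[lo, hi]) f x)%R = F hi - F lo.
Proof.
move=> lohi fint fcont dF Flo Fhi.
pose G x := parameterized_integral lebesgue_measure lo x f.
have /(continuous_within_itvP _ lohi)[_ Glo Ghi] :
  {within `[lo, hi], continuous G}.
  exact: parameterized_integral_continuous (ltW lohi) fint.
have GF u v : lo < u -> u < v -> v < hi -> G v - G u = F v - F u.
  move=> lou uv vhi.
  have uvin x : u <= x <= v -> lo < x < hi.
    by case/andP=> ux xv; rewrite (lt_le_trans lou) //= (le_lt_trans xv).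
  rewrite /G /parameterized_integral Rintegral_itvB; last 3 first.
  - apply: integrableS fint => //= x /=; rewrite !in_itv /= => /andP[-> xv] /=.
    exact: le_trans xv (ltW vhi).
  - by rewrite bnd_simp ltW.
  - by rewrite bnd_simp ltW.
  rewrite Rintegral_itv_obnd_cbnd; last first.
    have := fint; apply: integrableS => //= x /=; rewrite !in_itv /= => /andP[ux xv].
    by rewrite ltW ?(lt_trans lou) //= (le_trans xv) // ltW.
  rewrite /Rintegral (@continuous_FTC2 _ f F) //.
  - apply/subspace_continuousP => x /=; rewrite in_itv /= => /uvin xin.
    exact: cvg_within_filter (fcont x xin).
  - have Fc x : lo < x < hi -> {for x, continuous F}.
      move=> /dF[dFx _]; exact/differentiable_continuous/derivable1_diffP.
    split=> [x||].
    + rewrite in_itv /= => /andP[ux xv].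
      by have [] : is_derive x 1 F (f x); [apply/dF/uvin; rewrite !ltW|].
    + by apply/cvg_at_right_filter/Fc/uvin; rewrite lexx ltW.
    + by apply/cvg_at_left_filter/Fc/uvin; rewrite lexx ltW.
  - move=> x; rewrite in_itv /= => /andP[ux xv]; rewrite derive1E.
    by have [] : is_derive x 1 F (f x); [apply/dF/uvin; rewrite !ltW|].
pose m := (lo + hi) / 2.
have [lom mhi] : lo < m /\ m < hi by rewrite /m; split; lra.
have Hc u : lo < u < hi -> G u - F u = G m - F m.
  case/andP=> lou uhi; case: (ltgtP u m) => [um|mu|->//].
    by have := GF u m lou um mhi; lra.
  by have := GF m u lom mu uhi; lra.
have Hlo : G lo - F lo = G m - F m.
  apply: (@cvg_unique _ _ ((fun x => G x - F x) x @[x --> lo^'+])) => //.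
    exact: cvgB.
  apply: cvg_near_cst; near=> x; apply: Hc; apply/andP; split; near: x.
    exact: nbhs_right_gt.
  exact: nbhs_right_lt.
have Hhi : G hi - F hi = G m - F m.
  apply: (@cvg_unique _ _ ((fun x => G x - F x) x @[x --> hi^'-])) => //.
    exact: cvgB.
  apply: cvg_near_cst; near=> x; apply: Hc; apply/andP; split; near: x.
    exact: nbhs_left_gt.
  exact: nbhs_left_lt.
have Glo0 : G lo = 0.
  by rewrite /G /parameterized_integral set_itv1 Rintegral_set1.
by rewrite -[LHS]/(G hi); lra.
Unshelve. all: by end_near.
Qed.

Lemma integrableM_poly (R : realType) (lo hi : R) (f : R -> R) (p : {poly R}) :
  lebesgue_measure.-integrable `[lo, hi] (EFin \o f) ->
  lebesgue_measure.-integrable `[lo, hi] (EFin \o (fun x => p.[x] * f x)).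
Proof.
move=> fint.
have -> : EFin \o (fun x => p.[x] * f x) =
    ((EFin \o horner p) \* (EFin \o f))%E.
  by apply/funext => x /=; rewrite EFinM.
apply: integrableMr => //.
  apply: measurable_funTS; apply: continuous_measurable_fun.
  exact: continuous_horner.
have : compact (horner p @` `[lo, hi]).
  apply: continuous_compact; last exact: segment_compact.
  exact/continuous_subspaceT/continuous_horner.
move/compact_bounded => bp.
case: bp => M [Mreal bM]; exists M; split=> // N /bM bN x xlohi.
by apply: bN; exists x.
Qed.

(** If the weight had infinite integral, so would its product with the square
    of the nonzero constant [p 0]; but the real-valued integral of that product
    is [1], whereas it is [0] for a function of infinite integral. *)
Lemma integrable_orthonormal_weight (R : realType) (lo hi : R) (w : R -> R)
    (p : nat -> {poly R}) :
  orthonormal_polys lo hi w p -> measurable_fun setT w -> (forall x, 0 <= w x) ->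
  lebesgue_measure.-integrable `[lo, hi] (EFin \o w).
Proof.
move=> [sizep _ /(_ 0 0)%N orth00] mw w0.
have /size_poly1P[e e0 pE] : size (p 0%N) == 1%N by rewrite sizep.
apply/integrableP; split; first exact/measurable_EFinP/measurable_funTS.
under eq_integral do rewrite /= ger0_norm //.
rewrite ltey; apply/eqP => intw.
move: orth00; rewrite eqxx pE /Rintegral.
under eq_integral do rewrite !hornerC EFinM.
rewrite ge0_integralZl_EFin //; last 3 first.
- by move=> x _; rewrite lee_fin.
- exact/measurable_EFinP/measurable_funTS.
- by rewrite -expr2 sqr_ge0.
rewrite intw gt0_muley /= => [/esym/eqP|]; first by rewrite oner_eq0.
by rewrite lte_fin -expr2 exprn_even_gt0.
Qed.

Definition moment (R : realType) (lo hi : R) (w : R -> R) (p : {poly R}) : R :=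
  (\int[lebesgue_measure]_(x in `[lo, hi]) (p.[x] * w x))%R.

Lemma moment_scalar (R : realType) (lo hi : R) (w : R -> R) :
  lebesgue_measure.-integrable `[lo, hi] (EFin \o w) ->
  scalar (moment lo hi w).
Proof.
move=> wint e p q; rewrite /moment.
rewrite -RintegralZl -?RintegralD //; try exact: integrableM_poly.
  by apply: eq_Rintegral => x _; rewrite hornerD hornerZ mulrDl mulrA.
have := integrableM_poly (e *: p) wint.
apply: eq_integrable => // x _ /=.
by rewrite hornerZ mulrA.
Qed.

(** * The Jacobi weight and its raising operator *)

(** The polynomial [J q] such that [(w^(d,c) q)' = w^(d-1,c-1) J q], where
    [w^(d,c)] is the weight [weightP]. *)
Definition jacobi_raise (R : realType) (gamma delta d c : R) (q : {poly R}) :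
    {poly R} :=
  q^`() * ((delta%:P - 'X) * ('X - gamma%:P))
  + q * (c *: (delta%:P - 'X) - d *: ('X - gamma%:P)).

Lemma size_jacobi_raise (R : realType) (gamma delta d c : R) (q : {poly R}) :
  (size (jacobi_raise gamma delta d c q) <= (size q).+1)%N.
Proof.
have [->|q0] := eqVneq q 0.
  by rewrite /jacobi_raise deriv0 !mul0r addr0 size_poly0.
have sizel (e : R) : (size (e%:P - 'X)%R <= 2)%N.
  by rewrite -opprB size_polyN size_XsubC.
have sizer : (size ('X - gamma%:P)%R <= 2)%N by rewrite size_XsubC.
rewrite /jacobi_raise (leq_trans (size_polyD _ _)) // geq_max; apply/andP; split.
  rewrite (leq_trans (size_polyMleq _ _)) //.
  have : (size ((delta%:P - 'X) * ('X - gamma%:P))%R <= 3)%N.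
    rewrite (leq_trans (size_polyMleq _ _)) // size_XsubC addn2 /=.
    by rewrite ltnS.
  have := lt_size_deriv q0; lia.
rewrite (leq_trans (size_polyMleq _ _)) //.
suff : (size (c *: (delta%:P - 'X) - d *: ('X - gamma%:P))%R <= 2)%N by lia.
rewrite (leq_trans (size_polyD _ _)) // size_polyN geq_max.
by rewrite !(leq_trans (size_scale_leq _ _)).
Qed.

Lemma jacobi_raiseM (R : realType) (gamma delta d c : R) (q r : {poly R}) :
  jacobi_raise gamma delta d c (q * r) = jacobi_raise gamma delta d c q * r
    + q * r^`() * ((delta%:P - 'X) * ('X - gamma%:P)).
Proof. by rewrite /jacobi_raise derivM; ring. Qed.

(** The scaling [r] stands for [rho x]; the Jacobi weight itself is [r = 1]. *)
Lemma is_derive_weight_poly (R : realType) (gamma delta d c r y : R)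
    (q : {poly R}) : 0 < r -> gamma * r < y < delta * r ->
  is_derive y 1
    (fun t => (t - gamma * r) `^ c * (delta * r - t) `^ d * q.[t / r])
    ((y - gamma * r) `^ (c - 1) * (delta * r - y) `^ (d - 1) * r
     * (jacobi_raise gamma delta d c q).[y / r]).
Proof.
move=> r0 /andP[gy yd].
have Y0 : 0 < y - gamma * r by rewrite subr_gt0.
have Z0 : 0 < delta * r - y by rewrite subr_gt0.
have dY : is_derive y 1 (fun t => t - gamma * r) 1.
  by apply: is_derive_eq; rewrite subr0.
have dZ : is_derive y 1 (fun t => delta * r - t) (-1).
  by apply: is_derive_eq; rewrite add0r mul1r.
have dX : is_derive y 1 (fun t => t / r) r^-1.
  by apply: is_derive_eq; rewrite scaler0 add0r /GRing.scale /= mulr1.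
have dYc := @is_derive1_comp R (fun z : R => z `^ c)
  (fun t : R => t - gamma * r) _ _ _
  (is_derive1_powR c Y0) dY.
have dZd := @is_derive1_comp R (fun z : R => z `^ d)
  (fun t : R => delta * r - t) _ _ _
  (is_derive1_powR d Z0) dZ.
have dq := @is_derive1_comp R (horner q) (fun t : R => t / r) _ _ _
  (is_derive_poly q (y / r)) dX.
have dYZ := is_deriveM dYc dZd.
have dYZq := is_deriveM dYZ dq.
apply: (is_derive_eq dYZq).
have powR_step (x e : R) : 0 < x -> x `^ e = x * x `^ (e - 1).
  move=> x0; rewrite powRB ?(gt_eqF x0) ?implybT // powRr1 ?ltW //.
  by rewrite mulrC divfK // gt_eqF.
rewrite !fctE /GRing.scale /= /jacobi_raise !hornerE /=.
rewrite (powR_step _ c Y0) (powR_step _ d Z0).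
by field; rewrite gt_eqF.
Qed.

Lemma weightP_poly_cvg_right (R : realType) (gamma delta d c : R) (q : {poly R}) :
  gamma < delta -> 0 < c ->
  q.[y] * weightP gamma delta d c y @[y --> gamma^'+] --> 0.
Proof.
move=> gd c0; rewrite -[X in _ --> X](mulr0 q.[gamma]); apply: cvgM.
  exact/cvg_at_right_filter/continuous_horner.
rewrite -[X in _ --> X](mulr0 ((delta - gamma) `^ d)); apply: cvgM.
  apply: cvg_at_right_filter.
  have dZ : is_derive gamma 1 (fun y => delta - y) (-1).
    by apply: is_derive_eq; rewrite add0r mul1r.
  have gd0 : 0 < delta - gamma by rewrite subr_gt0.
  have [+ _] := @is_derive1_comp R (fun z : R => z `^ d)
    (fun t : R => delta - t) _ _ _ (is_derive1_powR d gd0) dZ.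
  by move=> /derivable1_diffP/differentiable_continuous.
move=> A /(powR_cvg0 c0) A0.
have {}A0 : \forall e \near 0^'+, A (e `^ c) by [].
apply/nbhs_right0P.
by move: A0; apply: filterS => e; rewrite /= (addrC gamma) addrK.
Qed.

Lemma weightP_poly_cvg_left (R : realType) (gamma delta d c : R) (q : {poly R}) :
  gamma < delta -> 0 < d ->
  q.[y] * weightP gamma delta d c y @[y --> delta^'-] --> 0.
Proof.
move=> gd d0; rewrite -[X in _ --> X](mulr0 q.[delta]); apply: cvgM.
  exact/cvg_at_left_filter/continuous_horner.
rewrite -[X in _ --> X](mul0r ((delta - gamma) `^ c)); apply: cvgM; last first.
  apply: cvg_at_left_filter.
  have dY : is_derive delta 1 (fun y => y - gamma) 1.
    by apply: is_derive_eq; rewrite subr0.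
  have gd0 : 0 < delta - gamma by rewrite subr_gt0.
  have [+ _] := @is_derive1_comp R (fun z : R => z `^ c)
    (fun t : R => t - gamma) _ _ _ (is_derive1_powR c gd0) dY.
  by move=> /derivable1_diffP/differentiable_continuous.
move=> A /(powR_cvg0 d0) A0.
have {}A0 : \forall e \near 0^'+, A (e `^ d) by [].
apply/nbhs_left0P.
by move: A0; apply: filterS => e; rewrite /= opprB addrC subrK.
Qed.

Lemma is_derive_weightP_poly (R : realType) (gamma delta d c y : R)
    (q : {poly R}) : gamma < y < delta ->
  is_derive y 1 (fun t => q.[t] * weightP gamma delta d c t)
    ((jacobi_raise gamma delta d c q).[y] * weightP gamma delta (d - 1) (c - 1) y).
Proof.
move=> yin; have := @is_derive_weight_poly R gamma delta d c 1 y q ltr01.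
rewrite !mulr1 => /(_ yin).
have -> : (fun t => (t - gamma) `^ c * (delta - t) `^ d * q.[t / 1]) =
    (fun t => q.[t] * weightP gamma delta d c t).
  by apply/funext => t; rewrite /weightP divr1; ring.
by move=> dF; apply: (is_derive_eq dF); rewrite /weightP divr1; ring.
Qed.

(** The integrand is the derivative of [q w^(d,c)], which vanishes at both end
    points. *)
Lemma moment_jacobi_raise (R : realType) (gamma delta d c : R) (q : {poly R}) :
  gamma < delta -> 0 < d -> 0 < c ->
  lebesgue_measure.-integrable `[gamma, delta]
    (EFin \o weightP gamma delta (d - 1) (c - 1)) ->
  moment gamma delta (weightP gamma delta (d - 1) (c - 1))
    (jacobi_raise gamma delta d c q) = 0.
Proof.
move=> gd d0 c0 wint.
pose F t := q.[t] * weightP gamma delta d c t.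
have F_gamma : F gamma = 0.
  by rewrite /F /weightP subrr powR0 ?gt_eqF // !mulr0.
have F_delta : F delta = 0.
  by rewrite /F /weightP subrr powR0 ?gt_eqF // mul0r mulr0.
transitivity (F delta - F gamma); last by rewrite F_gamma F_delta subr0.
apply: improper_FTC2 => //; rewrite ?F_gamma ?F_delta.
- exact: integrableM_poly.
- move=> x xin.
  (* The integrand is again a polynomial times a Jacobi weight, so it is
     differentiable inside, in particular continuous. *)
  have [+ _] := is_derive_weightP_poly (d - 1) (c - 1)
    (jacobi_raise gamma delta d c q) xin.
  by move=> /derivable1_diffP/differentiable_continuous.
- by move=> x; exact: is_derive_weightP_poly.
- exact: weightP_poly_cvg_right.
- exact: weightP_poly_cvg_left.
Qed.

Lemma measurable_weightP (R : realType) (gamma delta d c : R) :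
  measurable_fun setT (weightP gamma delta d c).
Proof.
apply: measurable_funM; apply: (measurableT_comp (measurable_powR _)).
  exact: measurable_funB.
exact: measurable_funB.
Qed.

Lemma weightP_ge0 (R : realType) (gamma delta d c y : R) :
  0 <= weightP gamma delta d c y.
Proof. by rewrite mulr_ge0 // powR_ge0. Qed.

Lemma moment_weightP_shift (R : realType) (gamma delta d c : R) (q : {poly R}) :
  0 < d -> 0 < c ->
  moment gamma delta (weightP gamma delta d c) q =
  moment gamma delta (weightP gamma delta (d - 1) (c - 1))
    (q * ((delta%:P - 'X) * ('X - gamma%:P))).
Proof.
move=> d0 c0; apply: eq_Rintegral => y.
rewrite inE /= in_itv /= => /andP[gy yd].
rewrite /weightP -(@mulr_powRB1 _ (delta - y) d) ?subr_ge0 //.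
rewrite -(@mulr_powRB1 _ (y - gamma) c) ?subr_ge0 //.
by rewrite !hornerE /=; ring.
Qed.

(** The Rodrigues-type identity, free of the weight: [adjoint_ladder] for the
    moment functionals of the two Jacobi weights.  The adjunction comes from
    integrating [w^(d-1,c-1) J (q r) = (w^(d,c) q r)']. *)
Lemma jacobi_ladder (R : realType) (gamma delta d c : R)
    (Pt : R -> R -> nat -> {poly R}) (k : nat) :
  gamma < delta -> is_Pfamily gamma delta Pt -> 0 < d -> 0 < c ->
  jacobi_raise gamma delta d c (Pt d c k) =
    - dconst Pt d c k *: Pt (d - 1) (c - 1) k.+1.
Proof.
move=> gd hPt d0 c0.
have onP : orthonormal_polys gamma delta (weightP gamma delta d c) (Pt d c).
  by apply: hPt; rewrite (lt_trans _ d0, lt_trans _ c0) // ltrN10.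
have onP' : orthonormal_polys gamma delta
    (weightP gamma delta (d - 1) (c - 1)) (Pt (d - 1) (c - 1)).
  by apply: hPt; rewrite ltrBrDl subrr.
have wint := integrable_orthonormal_weight onP
  (@measurable_weightP _ _ _ _ _) (@weightP_ge0 _ _ _ _ _).
have wint' := integrable_orthonormal_weight onP'
  (@measurable_weightP _ _ _ _ _) (@weightP_ge0 _ _ _ _ _).
pose m := moment gamma delta (weightP gamma delta d c).
pose m' := moment gamma delta (weightP gamma delta (d - 1) (c - 1)).
pose L : {scalar {poly R}} :=
  HB.pack m (GRing.isLinear.Build _ _ _ _ m (moment_scalar wint)).
pose L' : {scalar {poly R}} :=
  HB.pack m' (GRing.isLinear.Build _ _ _ _ m' (moment_scalar wint')).
have Lp : orthonormal_for L (Pt d c).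
  split=> [|i j]; first by case: onP.
  case: onP => _ _ <-; apply: eq_Rintegral => y _.
  by rewrite hornerM.
have Lp' : orthonormal_for L' (Pt (d - 1) (c - 1)).
  split=> [|i j]; first by case: onP'.
  case: onP' => _ _ <-; apply: eq_Rintegral => y _.
  by rewrite hornerM.
have Jadj q r : L (q * r^`()) = - L' (jacobi_raise gamma delta d c q * r).
  rewrite [LHS]moment_weightP_shift //; apply/eqP.
  rewrite -addr_eq0 addrC -[X in _ + X]/(L' _) -linearD -jacobi_raiseM.
  exact/eqP/moment_jacobi_raise.
apply: (adjoint_ladder Lp Lp' (size_jacobi_raise gamma delta d c) Jadj).
have [e eE] := deriv_ladder Lp Lp' (size_jacobi_raise gamma delta d c) Jadj k.
exact: (@xgetPex _ 0 [set e : R | (Pt (d - 1) (c - 1) k.+1)^`() = e *: Pt d c k]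
  (ex_intro _ e eE)).
Qed.

(** * The derivative of the weighted Koornwinder polynomials *)

Lemma yinterior_rho_gt0 (R : realType) (alpha beta gamma delta : R)
    (rho : R -> R) (x y : R) :
  gamma < delta -> yinterior alpha beta gamma delta rho x y -> 0 < rho x.
Proof.
move=> gd [_ /andP[gy yd]].
have := lt_trans gy yd; rewrite -subr_gt0 -mulrBl pmulr_rgt0 //.
by rewrite subr_gt0.
Qed.

Lemma is_derive_koornwinder (R : realType) (alpha beta gamma delta : R)
    (rho : R -> R) (Rp : R -> R -> R -> nat -> {poly R})
    (Pt : R -> R -> nat -> {poly R}) (a b c d : R) (n k : nat) (x y : R) :
  gamma < delta -> is_Pfamily gamma delta Pt -> 0 < c -> 0 < d ->
  yinterior alpha beta gamma delta rho x y ->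
  is_derive y 1
    (fun t => weightW alpha beta gamma delta rho a b c d x t
              * koornwinder rho Rp Pt a b c d n k x t)
    (- dconst Pt d c k
     * weightW alpha beta gamma delta rho a b (c - 1) (d - 1) x y
     * koornwinder rho Rp Pt a b (c - 1) (d - 1) n.+1 k.+1 x y).
Proof.
move=> gd hPt c0 d0 xy; have r0 := yinterior_rho_gt0 gd xy.
case: xy => _ yin.
pose C := (beta - x) `^ a * (x - alpha) `^ b *
  ((Rp a b (c + d + 2 * k%:R + 1) (n - k)%N).[x] * rho x ^+ k).
have dG := is_deriveZ C (is_derive_weight_poly d c (Pt d c k) r0 yin).
have -> : (fun t => weightW alpha beta gamma delta rho a b c d x t
              * koornwinder rho Rp Pt a b c d n k x t) =
    C *: (fun t => (t - gamma * rho x) `^ c * (delta * rho x - t) `^ d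
              * (Pt d c k).[t / rho x]).
  by apply/funext => t; rewrite fctE /GRing.scale /= /weightW /koornwinder /C; ring.
apply: (is_derive_eq dG).
have paramE : c - 1 + (d - 1) + 2 * k.+1%:R + 1 = c + d + 2 * k%:R + 1.
  by rewrite -natr1; ring.
rewrite (jacobi_ladder k gd hPt d0 c0) hornerZ /weightW /koornwinder paramE subSS.
by rewrite exprS /GRing.scale /= /C; ring.
Qed.

(** * Linear independence and the uniqueness of the matrix *)

(** On the curve [y = t rho x] the weight is a nonzero factor and
    [H_{i,k} = R_{i-k}(x) rho(x)^k P_k(t)].  For fixed [x] a vanishing
    combination is a polynomial in [t], which isolates each [k]; the coefficient
    of [P_k], divided by [rho(x)^k], is then a polynomial in [x]. *)
Lemma koornwinder_free (R : realType) (alpha beta gamma delta : R)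
    (rho : R -> R) (Rp : R -> R -> R -> nat -> {poly R})
    (Pt : R -> R -> nat -> {poly R}) (a b c d : R) (N : nat)
    (m : nat -> nat -> R) :
  alpha < beta -> gamma < delta -> (forall x, alpha < x < beta -> 0 < rho x) ->
  (forall k n, size (Rp a b (c + d + 2 * k%:R + 1) n) = n.+1) ->
  (forall n, size (Pt d c n) = n.+1) ->
  (forall x y, yinterior alpha beta gamma delta rho x y ->
     \sum_(i < N) \sum_(k < i.+1)
       weightW alpha beta gamma delta rho a b c d x y
       * koornwinder rho Rp Pt a b c d i k x y * m i k = 0) ->
  forall i k, (i < N)%N -> (k <= i)%N -> m i k = 0.
Proof.
move=> ab gd rho0 sizeR sizeP sum0.
pose Rk k i := Rp a b (c + d + 2 * k%:R + 1) (i - k)%N.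
have sumP x : alpha < x < beta ->
    \sum_(k < N)
      (\sum_(i < N | (k <= i)%N) m i k * ((Rk k i).[x] * rho x ^+ k))
        *: Pt d c k = 0.
  move=> xin; have r0 := rho0 x xin.
  apply: (poly_eq0_itv gd) => t /andP[gt td].
  have yin : yinterior alpha beta gamma delta rho x (t * rho x).
    split; first by case/andP: xin => *; rewrite !ltW.
    by rewrite !ltr_pM2r // gt td.
  have W0 : weightW alpha beta gamma delta rho a b c d x (t * rho x) != 0.
    case/andP: xin => ax xb.
    rewrite gt_eqF // /weightW -!mulrBl !mulr_gt0 // powR_gt0 ?mulr_gt0 ?subr_gt0 //.
  apply: (mulfI W0); rewrite mulr0 -[RHS](sum0 x _ yin).
  rewrite horner_sum mulr_sumr.
  pose f i k := weightW alpha beta gamma delta rho a b c d x (t * rho x)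
       * koornwinder rho Rp Pt a b c d i k x (t * rho x) * m i k.
  transitivity (\sum_(i < N) \sum_(k < N | (k < i.+1)%N) f i k); last first.
    by apply: eq_bigr => i _; rewrite [RHS](big_ord_widen N (f i)).
  rewrite (exchange_big_dep predT) //=; apply: eq_bigr => k _.
  rewrite hornerZ mulr_suml mulr_sumr; apply: eq_bigr => i _.
  by rewrite /f /koornwinder mulfK ?gt_eqF // /Rk; ring.
have coef0 x k : alpha < x < beta -> (k < N)%N ->
    \sum_(i < N | (k <= i)%N) m i k * ((Rk k i).[x] * rho x ^+ k) = 0.
  move=> xin kN; apply: (@size_incr_free _ (Pt d c) predT _ _ N
    (fun k => \sum_(i < N | (k <= i)%N) m i k * ((Rk k i).[x] * rho x ^+ k))
    (sumP x xin)) => //.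
    by move=> j _; rewrite -size_poly_gt0 sizeP.
  by move=> i j _ _; rewrite !sizeP.
move=> i k iN ki.
have sumR : \sum_(i < N | (k <= i)%N) m i k *: Rk k i = 0.
  apply: (poly_eq0_itv ab) => x xin.
  have rk0 : rho x ^+ k != 0 by rewrite expf_neq0 // gt_eqF // rho0.
  apply: (mulIf rk0); rewrite mul0r -[RHS](coef0 x k xin (leq_ltn_trans ki iN)).
  rewrite horner_sum mulr_suml; apply: eq_bigr => j _.
  by rewrite hornerZ mulrA.
apply: (@size_incr_free _ (Rk k) (fun i => k <= i)%N _ _ N (fun i => m i k) sumR)
  => // [j kj|j1 j2 kj1 kj2 j12].
  by rewrite -size_poly_gt0 sizeR.
by rewrite !sizeR; lia.
Qed.

Lemma integrable_itv_oo_cc (R : realType) (lo hi : R) (f : R -> R) :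
  lebesgue_measure.-integrable `]lo, hi[ (EFin \o f) ->
  lebesgue_measure.-integrable `[lo, hi] (EFin \o f).
Proof.
move=> /integrableP[mf intf]; apply/integrableP; split.
  by move/measurable_EFinP: mf => /measurable_fun_itv_cc/measurable_EFinP.
rewrite integral_itv_bndoo //.
by apply: measurableT_comp.
Qed.

(** Raising [s] by an even integer multiplies the weight by an even power of
    [rho], which is a polynomial in both admissible cases and so bounded.  This
    holds inside the interval only: at an end point [rho] may vanish, where
    powers with exponents [<= 0] take conventional values. *)
Lemma integrable_weightR_incr (R : realType) (alpha beta gamma delta : R)
    (rho : R -> R) (eta : bool) (a b s : R) (k : nat) :
  admissible_rho alpha beta gamma delta rho eta ->
  integrable_weightR alpha beta rho a b s ->
  integrable_weightR alpha beta rho a b (s + 2 * k%:R).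
Proof.
move=> [rho0 [q [_ rhoE]] _] wint.
have [r rE] : exists r : {poly R},
    forall x, alpha < x < beta -> rho x ^+ (2 * k) = r.[x].
  exists (if eta then q ^+ k else q ^+ (2 * k)) => x xin.
  have := rho0 x xin; rewrite rhoE; last by case/andP: xin => *; rewrite !ltW.
  case: {rhoE} eta => [|_]; last by rewrite horner_exp.
  by rewrite sqrtr_gt0 => q0; rewrite exprM sqr_sqrtr ?horner_exp // ltW.
apply: integrable_itv_oo_cc.
have : lebesgue_measure.-integrable `]alpha, beta[
    (EFin \o (fun x => r.[x] * weightR alpha beta rho a b s x)).
  have := integrableM_poly r wint; apply: integrableS => //.
  exact: subset_itvW.
apply: eq_integrable => // x; rewrite inE /= in_itv /= => xin.
have r0 := rho0 x xin.
rewrite -rE // /weightR powRD ?(gt_eqF r0) ?implybT //.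
rewrite -[2 * k%:R]natrM powR_mulrn ?ltW //.
by congr EFin; ring.
Qed.

(** The two column supports may be bounded by different [N]; padding both sums
    with zero terms up to the larger bound allows subtracting them. *)
Lemma is_Wy_unique (R : realType) (alpha beta gamma delta : R) (rho : R -> R)
    (Rp : R -> R -> R -> nat -> {poly R}) (Pt : R -> R -> nat -> {poly R})
    (a b c d : R) (M M' : inf_blockmx R) :
  alpha < beta -> gamma < delta -> (forall x, alpha < x < beta -> 0 < rho x) ->
  (forall k n, size (Rp a b (c - 1 + (d - 1) + 2 * k%:R + 1) n) = n.+1) ->
  (forall n, size (Pt (d - 1) (c - 1) n) = n.+1) ->
  is_Wy alpha beta gamma delta rho Rp Pt a b c d M ->
  is_Wy alpha beta gamma delta rho Rp Pt a b c d M' -> M = M'.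
Proof.
move=> ab gd rho0 sizeR sizeP MW MW'.
apply: functional_extensionality_dep => i.
apply: functional_extensionality_dep => j.
apply/matrixP => k l.
have [N [M0 dM]] := MW j l; have [N' [M0' dM']] := MW' j l.
have [iN|Ni] := ltnP i (maxn N N'); last first.
  by move: Ni; rewrite geq_max => /andP[Ni Ni']; rewrite M0 // M0'.
pose H x y i' k' := weightW alpha beta gamma delta rho a b (c - 1) (d - 1) x y
  * koornwinder rho Rp Pt a b (c - 1) (d - 1) i' k' x y.
have extend (n : nat) (A : inf_blockmx R) x y : (n <= maxn N N')%N ->
    (forall i' (k' : 'I_i'.+1), (n <= i')%N -> A i' j k' l = 0) ->
    \sum_(i' < n) \sum_(k' < i'.+1) H x y i' k' * A i' j k' l =
    \sum_(i' < maxn N N') \sum_(k' < i'.+1) H x y i' k' * A i' j k' l.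
  move=> nN A0; pose f i' := \sum_(k' < i'.+1) H x y i' k' * A i' j k' l.
  rewrite (big_ord_widen _ f nN) big_mkcond; apply: eq_bigr => i' _.
  by case: ltnP => // ni; rewrite big1 // => k' _; rewrite A0 ?mulr0.
pose m i' k' := M i' j (inord k') l - M' i' j (inord k') l.
suff : m i k = 0 by rewrite /m inord_val => /subr0_eq.
apply: (koornwinder_free ab gd rho0 sizeR sizeP _ iN) => [x y xy|]; last first.
  by rewrite -ltnS.
have [_ dE] := dM x y xy; have [_ dE'] := dM' x y xy.
move: dE; rewrite dE' (extend _ M) ?leq_maxl // (extend _ M') ?leq_maxr //.
move=> /esym/eqP; rewrite -subr_eq0 => /eqP sum0.
rewrite -[RHS]sum0 -sumrB; apply: eq_bigr => i' _.
rewrite -sumrB; apply: eq_bigr => k' _.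
by rewrite /m inord_val mulrBr.
Qed.

(** * The matrix and the theorem *)

Definition shift_blockmx (R : realType) (e : nat -> R) : inf_blockmx R :=
  fun i j => \matrix_(k < i.+1, l < j.+1)
    if (i == j.+1) && (val k == l.+1) then e l else 0.

Lemma shift_blockmx_sum (R : realType) (e : nat -> R) (h : nat -> nat -> R)
    (j : nat) (l : 'I_j.+1) :
  \sum_(i < j.+2) \sum_(k < i.+1) h i k * shift_blockmx e i j k l =
  h j.+1 l.+1 * e l.
Proof.
rewrite big_ord_recr /= big1 ?add0r => [|i _]; last first.
  by rewrite big1 // => k _; rewrite mxE ltn_eqF ?mulr0.
have lj : (l.+1 < j.+2)%N by rewrite ltnS ltn_ord.
rewrite (bigD1 (Ordinal lj)) //= mxE !eqxx big1 ?addr0 // => k kl.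
by rewrite mxE eqxx /= ifN ?mulr0 //; exact: kl.
Qed.

Theorem proposition5p4 (R : realType) (alpha beta gamma delta : R)
    (rho : R -> R) (eta : bool)
    (Rp : R -> R -> R -> nat -> {poly R}) (Pt : R -> R -> nat -> {poly R})
    (a b c d : R)
    (hab : alpha < beta) (hgd : gamma < delta)
    (hrho : admissible_rho alpha beta gamma delta rho eta)
    (hRp : is_Rfamily alpha beta rho Rp)
    (hPt : is_Pfamily gamma delta Pt)
    (ha : 0 < a) (hb : 0 < b) (hc : 0 < c) (hd : 0 < d)
    (hcd : eta -> c = d) :
  (forall (n k : nat), (k <= n)%N ->
     forall x y : R, yinterior alpha beta gamma delta rho x y ->
       is_derive y 1
         (fun t => weightW alpha beta gamma delta rho a b c d x t
                   * koornwinder rho Rp Pt a b c d n k x t)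
         (- dconst Pt d c k
          * weightW alpha beta gamma delta rho a b (c - 1) (d - 1) x y
          * koornwinder rho Rp Pt a b (c - 1) (d - 1) n.+1 k.+1 x y)) /\
  (integrable_weightR alpha beta rho a b (c + d - 1) ->
   exists Wy : inf_blockmx R,
     [/\ unique (is_Wy alpha beta gamma delta rho Rp Pt a b c d) Wy,
         block_bandwidths 1 (-1) Wy &
         forall i j : nat, bandwidths 1 (-1) (Wy i j)]).
Proof.
have dWH n k x y := @is_derive_koornwinder R alpha beta gamma delta rho Rp Pt
  a b c d n k x y hgd hPt hc hd.
split=> [n k _ x y|wint]; first exact: dWH.
have sizeR k n : size (Rp a b (c - 1 + (d - 1) + 2 * k%:R + 1) n) = n.+1.
  have -> : c - 1 + (d - 1) + 2 * k%:R + 1 = c + d - 1 + 2 * k%:R by ring.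
  have k0 : 0 <= 2 * k%:R :> R by rewrite mulr_ge0.
  have [a1 b1 s1] : [/\ -1 < a, -1 < b & -1 < c + d - 1 + 2 * k%:R].
    by split; lra.
  by have [] := hRp _ _ _ a1 b1 s1 (integrable_weightR_incr k hrho wint).
have sizeP n : size (Pt (d - 1) (c - 1) n) = n.+1.
  by have [] := hPt (d - 1) (c - 1) _ _; rewrite ?ltrBrDl ?subrr.
have rho0 : forall x, alpha < x < beta -> 0 < rho x by case: hrho.
pose Wy := shift_blockmx (fun l => - dconst Pt d c l).
have WyP : is_Wy alpha beta gamma delta rho Rp Pt a b c d Wy.
  move=> j l; exists j.+2; split=> [i k ji|x y xy].
    by rewrite mxE gtn_eqF.
  rewrite (shift_blockmx_sum _ (fun i k => _ * koornwinder _ _ _ _ _ _ _ i k x y)).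
  by apply: (is_derive_eq (dWH _ _ _ _ xy)); ring.
exists Wy; split.
- by split=> // M; apply: is_Wy_unique WyP.
- move=> i j ij; apply/matrixP => k l; rewrite !mxE ifF //.
  by apply/negbTE/negP => /andP[/eqP ijE _]; move: ij; rewrite ijE; lia.
- move=> i j k l kl; rewrite mxE ifF //.
  by apply/negbTE/negP => /andP[_ /eqP klE]; move: kl; rewrite klE; lia.
Qed.
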